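(* If $\overline{\mathbf u}^h\in V^h$ and $\hat{\overline{\mathbf u}}^h\in\hat V^h$ satisfy $$\sum_e\int_{\Omega_e}\frac1\rho\,\nabla\cdot\overline{\mathbf u}^h\,q^h\,d\Omega=0\qquad\forall q^h\in Q^h$$ and $$\sum_e\sum_i\int_{\Gamma_{e_i}}\frac1\rho\,\overline{\mathbf u}^h\cdot\mathbf n\,\hat q^h\,d\Gamma-\int_{\partial\Omega}\frac1\rho\,\hat{\overline{\mathbf u}}^h\cdot\mathbf n\,\hat q^h\,d\Gamma=0\qquad\forall\hat q^h\in\hat Q^h,$$ then $$\nabla\cdot\overline{\mathbf u}^h=0\quad\forall\mathbf x\in\Omega_e,\ \forall\Omega_e\in\mathcal T,$$ and $$[\![\overline{\mathbf u}^h]\!]=0\quad\forall\mathbf x\in F,\ \forall F\in\mathcal F_{\mathrm{int}},\qquad \overline{\mathbf u}^h\cdot\mathbf n=\hat{\overline{\mathbf u}}^h\cdot\mathbf n\quad\forall\mathbf x\in F,\ \forall F\in\mathcal F_{\mathrm{bdy}}.$$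
   Context: $\Omega\subset\mathbb R^d$ ($d=2$ or $3$) is a bounded Lipschitz domain and $\rho>0$ is a constant. $\mathcal T=\{\Omega_e\}_{e=1}^{\mathrm{nel}}$ is a triangulation of $\Omega$ into non-overlapping simplices. $\Gamma_{e_i}$ is the $i$-th facet (edge if $d=2$, face if $d=3$) of $\Omega_e$; on $\Gamma_{e_i}$, $\mathbf n$ is the unit normal outward to $\Omega_e$ (on $\partial\Omega$ it is the unit outward normal to $\Omega$). A facet shared by two adjacent elements is an interior facet; a facet lying on $\partial\Omega$ is a boundary facet. $\mathcal F_{\mathrm{int}}$, $\mathcal F_{\mathrm{bdy}}$ are the sets of interior and boundary facets, $\mathcal F=\mathcal F_{\mathrm{int}}\cup\mathcal F_{\mathrm{bdy}}$, and $\tilde\Gamma=\cup_{F\in\mathcal F}F$ is the mesh skeleton. $P_k(D)$ is the space of polynomials of degree $k$ (i.e. at most $k$) on $D$. For polynomial degree $k\ge1$: $V^h=\{\mathbf v^h\in[L^2(\Omega)]^d:\mathbf v^h|_{\Omega_e}\in[P_k(\Omega_e)]^d\ \forall\Omega_e\in\mathcal T\}$, $\hat V^h=\{\hat{\mathbf v}^h\in[L^2(\tilde\Gamma)]^d:\hat{\mathbf v}^h|_F\in[P_k(F)]^d\ \forall F\in\mathcal F\}$, $Q^h=\{q^h\in L^2(\Omega):q^h|_{\Omega_e}\in P_{k-1}(\Omega_e)\ \forall\Omega_e\in\mathcal T\}$, $\hat Q^h=\{\hat q^h\in L^2(\tilde\Gamma):\hat q^h|_F\in P_k(F)\ \forall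 F\in\mathcal F\}$. For an interior facet $F$ shared by $\Omega_{e^+}$ and $\Omega_{e^-}$, with unit normals $\mathbf n^\pm$ on $F$ outward to $\Omega_{e^\pm}$ and traces $\mathbf y^\pm$ on $F$ of $\mathbf y|_{\Omega_{e^\pm}}$, the jump is $[\![\mathbf y]\!]=\mathbf y^+\cdot\mathbf n^++\mathbf y^-\cdot\mathbf n^-$. In integrals over $\Gamma_{e_i}$, $\overline{\mathbf u}^h$ denotes the trace from $\Omega_e$. *)

(* Defs.v *)
From HB Require Import structures.
From mathcomp Require Import all_boot all_order all_algebra.
From mathcomp Require Import all_classical all_reals all_analysis.

Set Implicit Arguments.
Unset Strict Implicit.
Unset Printing Implicit Defensive.

Import Order.TTheory GRing.Theory Num.Theory.
Import numFieldNormedType.Exports.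

Local Open Scope classical_set_scope.
Local Open Scope ring_scope.

(** * Lebesgue measure on row vectors *)

Definition rV_display : measure_display -> measure_display.
Proof. exact. Qed.

(* 'rV[R]_n carries the sigma-algebra generated by the coordinates. *)
Section measurable_rV.
Context {R : realType}.
Variable n : nat.

Let coors : 'I_n -> 'rV[R]_n -> R := fun i x => x ord0 i.

Let rV_set0 : g_sigma_preimage coors set0.
Proof. exact: sigma_algebra0. Qed.

Let rV_setC A : g_sigma_preimage coors A -> g_sigma_preimage coors (~` A).
Proof. exact: sigma_algebraC. Qed.

Let rV_bigcup (F : _^nat) : (forall i, g_sigma_preimage coors (F i)) ->
  g_sigma_preimage coors (\bigcup_i (F i)).
Proof. exact: sigma_algebra_bigcup. Qed.

HB.instance Definition _ :=
  @isMeasurable.Build (rV_display default_measure_display)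
    'rV[R]_n (g_sigma_preimage coors) rV_set0 rV_setC rV_bigcup.

End measurable_rV.

Lemma measurable_coord (R : realType) n (i : 'I_n) :
  measurable_fun [set: 'rV[R]_n] (fun x : 'rV[R]_n => x ord0 i).
Proof.
move=> _ Y mY; rewrite setTI; apply: sub_sigma_algebra => /=.
rewrite -bigcup_seq/=; exists i => /=; first by rewrite mem_index_enum.
by exists Y => //; rewrite setTI.
Qed.

Lemma measurable_fun_rVP (R : realType) d1 (T1 : measurableType d1) n
    (f : T1 -> 'rV[R]_n) :
  measurable_fun [set: T1] f <->
  forall i, measurable_fun [set: T1] (fun t => f t ord0 i).
Proof.
split=> [mf i|mf].
  by apply: (@measurableT_comp _ _ _ _ _ _ (fun x : 'rV[R]_n => x ord0 i)) => //;
     exact: measurable_coord.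
suff : g_sigma_preimage (fun i t => f t ord0 i) `<=` measurable.
  rewrite (@g_sigma_preimage_comp _ _ n _ (fun i (x : 'rV[R]_n) => x ord0 i)).
  by move=> sf _ A mA; apply: sf; exists A.
apply: smallest_sub; first exact: sigma_algebra_measurable.
case: n => [|n] in f mf *; first by rewrite big_ord0.
rewrite -bigcup_mkord_ord; apply: bigcup_sub => i Ii.
by move=> A [B mB <-]; exact: mf.
Qed.

Definition cons_rV (R : realType) n (p : R * 'rV[R]_n) : 'rV[R]_n.+1 :=
  \row_i (if unlift ord0 i is Some j then p.2 ord0 j else p.1).

Definition uncons_rV (R : realType) n (x : 'rV[R]_n.+1) : R * 'rV[R]_n :=
  (x ord0 ord0, \row_j x ord0 (lift ord0 j)).

Lemma cons_rVK (R : realType) n : cancel (@cons_rV R n) (@uncons_rV R n).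
Proof.
case=> a x; rewrite /uncons_rV mxE unlift_none; congr pair.
by apply/rowP => j; rewrite !mxE liftK.
Qed.

Lemma uncons_rVK (R : realType) n : cancel (@uncons_rV R n) (@cons_rV R n).
Proof.
by move=> x; apply/rowP => i; rewrite mxE; case: unliftP => [j|] -> /=; rewrite ?mxE.
Qed.

Lemma measurable_cons_rV (R : realType) n : measurable_fun setT (@cons_rV R n).
Proof.
apply/measurable_fun_rVP => i.
under eq_fun do rewrite mxE.
case: unliftP => [j _|_]; last exact: measurable_fst.
apply: (@measurableT_comp _ _ _ _ _ _ (fun x : 'rV[R]_n => x ord0 j)) => //.
exact: measurable_coord.
Qed.

Lemma measurable_uncons_rV (R : realType) n :
  measurable_fun setT (@uncons_rV R n).
Proof.
apply: measurable_fun_pair; first exact: measurable_coord.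
apply/measurable_fun_rVP => i.
by under eq_fun do rewrite mxE; exact: measurable_coord.
Qed.

(* The corresponding canonical instance is not inferred. *)
Lemma product_sigma_finite d1 d2 (T1 : measurableType d1)
    (T2 : measurableType d2) (R : realType)
    (m1 : {sigma_finite_measure set T1 -> \bar R})
    (m2 : {sigma_finite_measure set T2 -> \bar R}) :
  sigma_finite setT (m1 \x m2)%E.
Proof.
have /sigma_finiteP[F [TF ndF Foo]] := sigma_finiteT m1.
have /sigma_finiteP[G [TG ndG Goo]] := sigma_finiteT m2.
exists (fun n => F n `*` G n).
  rewrite -setXTT TF TG predeqE => -[x y]; split.
    move=> [/= [n _ Fnx] [k _ Gky]]; exists (maxn n k) => //; split.
    - by move: x Fnx; exact/subsetPset/ndF/leq_maxl.
    - by move: y Gky; exact/subsetPset/ndG/leq_maxr.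
  by move=> [n _ []/= ? ?]; split; exists n.
move=> k; have [? ?] := Foo k; have [? ?] := Goo k.
split; first exact: measurableX.
by rewrite product_measure1E// lte_mul_pinfty// ge0_fin_numE.
Qed.

Section leb_step.
Context {R : realType} {n : nat}.
Variable m : {sigma_finite_measure set 'rV[R]_n -> \bar R}.

Definition leb_step : set 'rV[R]_n.+1 -> \bar R :=
  pushforward (@lebesgue_measure R \x m)%E (@cons_rV R n).

Let mcons := @measurable_cons_rV R n.

Let leb_step0 : leb_step set0 = 0%E.
Proof. exact: measure0. Qed.

Let leb_step_ge0 A : (0 <= leb_step A)%E.
Proof. exact: measure_ge0. Qed.

Let leb_step_sigma_additive : semi_sigma_additive leb_step.
Proof. exact: (@measure_semi_sigma_additive _ _ _
  [the measure _ _ of pushforward (@lebesgue_measure R \x m)%E (@cons_rV R n)]). Qed.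

HB.instance Definition _ := isMeasure.Build _ _ _ leb_step
  leb_step0 leb_step_ge0 leb_step_sigma_additive.

Let leb_step_sigma_finite : sigma_finite setT leb_step.
Proof.
have [F FT Ffin] := product_sigma_finite
  [the {sigma_finite_measure set _ -> \bar R} of @lebesgue_measure R] m.
exists (fun k => @uncons_rV R n @^-1` F k).
  by rewrite -preimage_bigcup -FT preimage_setT.
move=> k; have [mF Foo] := Ffin k; split.
  by rewrite -[X in measurable X]setTI; exact: measurable_uncons_rV.
rewrite /leb_step /pushforward -comp_preimage.
by rewrite (_ : _ \o _ = id) ?preimage_id//; apply/funext => p /=; exact: cons_rVK.
Qed.

HB.instance Definition _ :=
  Measure_isSigmaFinite.Build _ _ _ leb_step leb_step_sigma_finite.

End leb_step.

(* n-dimensional Lebesgue measure, as an iterated product. *)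
Fixpoint leb (R : realType) (n : nat) :
    {sigma_finite_measure set 'rV[R]_n -> \bar R} :=
  match n with
  | 0 => [the {sigma_finite_measure set 'rV[R]_0 -> \bar R} of \d_(0 : 'rV[R]_0)]
  | n'.+1 => [the {sigma_finite_measure set 'rV[R]_n'.+1 -> \bar R}
               of leb_step (leb R n')]
  end.

(* The notations of [mpoly] clash with those of analysis; its modules
   [Measure] and [isMeasure] shadow those used above. *)
From mathcomp Require Import -(notations) mpoly.

(** * Euclidean geometry and Lipschitz domains *)

Definition dotv (R : realType) d (u v : 'rV[R]_d) : R :=
  \sum_(i < d) u ord0 i * v ord0 i.

Definition frontier (T : topologicalType) (A : set T) : set T :=
  closure A `\` interior A.

(* Near each boundary point, O is the strict epigraph, in the direction of some
   unit vector nu, of a Lipschitz function gam of the projection onto the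
   hyperplane orthogonal to nu. *)
Definition lipschitz_boundary (R : realType) d (O : set 'rV[R]_d) : Prop :=
  forall x, frontier O x -> exists (nu : 'rV[R]_d) (gam : 'rV[R]_d -> R),
    [/\ dotv nu nu = 1, lipschitz gam &
      \forall y \near x, O y <-> gam (y - dotv y nu *: nu) < dotv y nu].

Definition bounded_lipschitz_domain (R : realType) d (O : set 'rV[R]_d) :=
  [/\ open O, connected O, O !=set0, bounded_set O & lipschitz_boundary O].

Definition reference_simplex (R : realType) n : set 'rV[R]_n :=
  [set t | (forall i, 0 < t ord0 i) /\ \sum_i t ord0 i < 1].

(** * Triangulations *)

Record mesh (R : realType) (d : nat) := Mesh {
  nnode : nat;
  node : 'I_nnode -> 'rV[R]_d;
  nel : nat;
  elt : 'I_nel -> {set 'I_nnode} }.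

Section mesh_geometry.
Context {R : realType} {d : nat}.
Variable T : mesh R d.
Implicit Types (S F : {set 'I_(nnode T)}) (e : 'I_(nel T)).

Definition affinely_independent S :=
  forall c : 'I_(nnode T) -> R, \sum_(i in S) c i = 0 ->
    \sum_(i in S) c i *: node i = 0 -> forall i, i \in S -> c i = 0.

Definition closed_simplex S : set 'rV[R]_d :=
  [set x | exists c : 'I_(nnode T) -> R,
    [/\ forall i, i \in S -> 0 <= c i, \sum_(i in S) c i = 1 &
        x = \sum_(i in S) c i *: node i]].

(* The relative interior of the simplex. *)
Definition open_simplex S : set 'rV[R]_d :=
  [set x | exists c : 'I_(nnode T) -> R,
    [/\ forall i, i \in S -> 0 < c i, \sum_(i in S) c i = 1 &
        x = \sum_(i in S) c i *: node i]].

Definition element e : set 'rV[R]_d := open_simplex (elt e).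

Definition triangulation (O : set 'rV[R]_d) : Prop :=
  [/\ forall e, #|elt e| = d.+1 /\ affinely_independent (elt e),
      closure O = \bigcup_e closed_simplex (elt e),
      forall e e', e != e' -> element e `&` element e' = set0 &
      forall e e', closed_simplex (elt e) `&` closed_simplex (elt e') =
        closed_simplex (elt e :&: elt e')].

(* Facets are named by their sets of nodes; as point sets they are the
   relatively open simplices [open_simplex F], so that distinct facets are
   disjoint. *)
Definition elt_facets e : {set {set 'I_(nnode T)}} :=
  [set elt e :\ i | i in elt e]%SET.

Definition facets : {set {set 'I_(nnode T)}} :=
  (\bigcup_e elt_facets e)%SET.

Definition interior_facets : {set {set 'I_(nnode T)}} :=
  [set F | [exists e, exists e',
    [&& e != e', F \in elt_facets e & F \in elt_facets e']]]%SET.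

Definition boundary_facets (O : set 'rV[R]_d) : {set {set 'I_(nnode T)}} :=
  [set F in facets | `[< closed_simplex F `<=` frontier O >]]%SET.

Definition outward_unit_normal (D : set 'rV[R]_d) F (n : 'rV[R]_d) : Prop :=
  [/\ dotv n n = 1,
      forall i j, i \in F -> j \in F -> dotv n (node i - node j) = 0 &
      forall x, open_simplex F x ->
        \forall t \near 0^'+, D (x - t *: n) /\ ~ D (x + t *: n)].

(** * Integration on facets *)

(* The i-th vertex of F, in the increasing order of nodes. *)
Definition facet_node F (i : nat) : 'rV[R]_d :=
  nth 0 [seq node j | j <- enum F] i.

Definition facet_edges F : 'M[R]_(d.-1, d) :=
  \matrix_(i < d.-1) (facet_node F i.+1 - facet_node F 0).

(* The affine parametrization of F by the reference (d-1)-simplex. *)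
Definition facet_param F (t : 'rV[R]_d.-1) : 'rV[R]_d :=
  facet_node F 0 + t *m facet_edges F.

(* The surface integral: the area element is the square root of the Gram
   determinant of the edge vectors. *)
Definition facet_integral F (f : 'rV[R]_d -> R) : R :=
  Num.sqrt (\det (facet_edges F *m (facet_edges F)^T)) *
  \int[leb R d.-1]_(t in @reference_simplex R d.-1) f (facet_param F t).

(** * Polynomial and broken polynomial spaces *)

(* [msize p] is the total degree plus one, and 0 for p = 0. *)
Definition poly_on (k : nat) (D : set 'rV[R]_d) (f : 'rV[R]_d -> R) : Prop :=
  exists p : mpoly d R, (mpoly.msize p <= k.+1)%N /\
    forall x, D x -> f x = meval (fun i => x ord0 i) p.

Definition L2 (D : set 'rV[R]_d) (f : 'rV[R]_d -> R) : Prop :=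
  measurable_fun D f /\
  (leb R d).-integrable D (fun x => (f x ^+ 2)%:E).

Definition L2_facet F (f : 'rV[R]_d -> R) : Prop :=
  measurable_fun (@reference_simplex R d.-1) (f \o facet_param F) /\
  (leb R d.-1).-integrable (@reference_simplex R d.-1)
    (fun t => (f (facet_param F t) ^+ 2)%:E).

(* Distinct facets meet in null sets, so square integrability on the skeleton
   is square integrability on each facet. *)
Definition L2_skeleton (f : 'rV[R]_d -> R) : Prop :=
  forall F, F \in facets -> L2_facet F f.

Definition coordf (v : 'rV[R]_d -> 'rV[R]_d) (j : 'I_d) : 'rV[R]_d -> R :=
  fun x => v x ord0 j.

Definition Vh k (O : set 'rV[R]_d) (v : 'rV[R]_d -> 'rV[R]_d) : Prop :=
  forall j, L2 O (coordf v j) /\ forall e, poly_on k (element e) (coordf v j).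

Definition Vhat k (v : 'rV[R]_d -> 'rV[R]_d) : Prop :=
  forall j, L2_skeleton (coordf v j) /\
    forall F, F \in facets -> poly_on k (open_simplex F) (coordf v j).

Definition Qh k (O : set 'rV[R]_d) (q : 'rV[R]_d -> R) : Prop :=
  L2 O q /\ forall e, poly_on k.-1 (element e) q.

Definition Qhat k (q : 'rV[R]_d -> R) : Prop :=
  L2_skeleton q /\
    forall F, F \in facets -> poly_on k (open_simplex F) q.

Definition divergence (v : 'rV[R]_d -> 'rV[R]_d) (x : 'rV[R]_d) : R :=
  \sum_(j < d) 'D_(delta_mx ord0 j) (coordf v j) x.

Definition trace_from e (v : 'rV[R]_d -> 'rV[R]_d) (x : 'rV[R]_d) : 'rV[R]_d :=
  lim (v @ within (element e) (nbhs x)).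

(* n e F : the unit normal on F outward to the element e. *)
Definition jump (n : 'I_(nel T) -> {set 'I_(nnode T)} -> 'rV[R]_d) F e e'
    (v : 'rV[R]_d -> 'rV[R]_d) (x : 'rV[R]_d) : R :=
  dotv (trace_from e v x) (n e F) + dotv (trace_from e' v x) (n e' F).

End mesh_geometry.

(* Main.v *)
(* On an element the divergence of u is a polynomial of degree at most k - 1 and
   on a facet the jump of the normal traces is a polynomial of degree at most k,
   so each is, after extension by zero, an admissible test function: testing
   against itself makes the integral of its square vanish, whence it is zero,
   because nonempty open sets have positive Lebesgue measure.

   The flux equation tested on F only involves the elements having F as a facet.
   Two of them have opposite normals at F, since their interiors are disjoint; in
   particular there are at most two.  A facet of two elements is not a boundary
   facet: elements lie in Omega (a Lipschitz domain is the interior of its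
   closure), so the normal of Omega at a boundary facet is outward to every
   element having it as a facet. *)
From mathcomp Require Import -(notations) mpoly.
Require Import Defs.
From mathcomp Require Import all_boot all_order all_algebra.
From mathcomp Require Import all_classical all_reals all_analysis.

Set Implicit Arguments.
Unset Strict Implicit.
Unset Printing Implicit Defensive.

Import Order.TTheory GRing.Theory Num.Theory.
Import numFieldNormedType.Exports.
Local Open Scope classical_set_scope.
Local Open Scope ring_scope.

(** * Polynomial functions *)

Section polynomial_functions.
Context {R : realType} {n : nat}.
Implicit Types (p q : mpoly n R) (x : 'rV[R]_n).

Definition peval p x : R := meval (fun i => x ord0 i) p.

(** Constants and variables generate the algebra: a monomial is a product of powers of variables.
    Analytic properties of [peval] then only need to be stable under sums and products. *)
Lemma mpoly_algebra_ind (P : mpoly n R -> Prop) :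
  (forall c, P (mpolyC n c)) ->
  (forall i, P (mpolyX R (mnm1 i))) ->
  (forall p q, P p -> P q -> P (p + q)) ->
  (forall p q, P p -> P q -> P (p * q)) -> forall p, P p.
Proof.
move=> PC PX PD PM p.
rewrite (mpolyE p); apply: (big_ind P (PC 0) PD) => m _.
rewrite -mul_mpolyC; apply: (PM); first exact: PC.
rewrite mpolyXE_id; apply: (big_ind P (PC 1) PM) => i _.
elim: (fun_of_multinom m i) => [|k IH].
  by rewrite expr0; exact: PC 1.
by rewrite exprS; exact: PM.
Qed.

Lemma pevalC c : peval (mpolyC n c) = fun=> c.
Proof. by apply/funext => x; rewrite /peval mevalC. Qed.

Lemma pevalX i : peval (mpolyX R (mnm1 i)) = fun x => x ord0 i.
Proof. by apply/funext => x; rewrite /peval mevalXU. Qed.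

Lemma pevalD p q : peval (p + q) = peval p \+ peval q.
Proof. by apply/funext => x; rewrite /peval mevalD. Qed.

Lemma pevalM p q : peval (p * q) = peval p \* peval q.
Proof. by apply/funext => x; rewrite /peval mevalM. Qed.

Lemma pevalZ a p : peval (a *: p) = fun x => a * peval p x.
Proof. by apply/funext => x; rewrite /peval mevalZ. Qed.

Lemma peval_sum (I : finType) (F : I -> mpoly n R) :
  peval (\sum_i F i) = fun x => \sum_i peval (F i) x.
Proof. by apply/funext => x; rewrite /peval raddf_sum. Qed.

Lemma msize_sum_le (I : finType) (F : I -> mpoly n R) m :
  (forall i, (msize (F i) <= m)%N) -> (msize (\sum_i F i) <= m)%N.
Proof.
move=> Fm; apply: leq_trans (msize_sum _ _ _) _.
by apply/bigmax_leqP => i _.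
Qed.

Lemma continuous_peval p : continuous (peval p).
Proof.
elim/mpoly_algebra_ind: p => [c|i|p q cp cq|p q cp cq] x.
- rewrite pevalC; exact: cst_continuous.
- rewrite pevalX; exact: (@coord_continuous R 1 n ord0 i).
- by rewrite pevalD; exact: (cvgD (cp x) (cq x)).
- by rewrite pevalM; exact: (cvgM (cp x) (cq x)).
Qed.

Lemma measurable_peval p : measurable_fun setT (peval p).
Proof.
elim/mpoly_algebra_ind: p => [c|i|p q mp mq|p q mp mq].
- by rewrite pevalC; exact: measurable_cst.
- by rewrite pevalX; exact: measurable_coord.
- by rewrite pevalD; exact: measurable_realfun.measurable_funD.
- by rewrite pevalM; exact: measurable_realfun.measurable_funM.
Qed.

Lemma peval_bounded p (D : set 'rV[R]_n) : bounded_set D ->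
  exists M, forall x, D x -> `|peval p x| <= M.
Proof.
move=> [M [_ /(_ (M + 1))]]; rewrite ltrDl => /(_ ltr01) DM.
elim/mpoly_algebra_ind: p => [c|i|p q [Mp Hp] [Mq Hq]|p q [Mp Hp] [Mq Hq]].
- by exists `|c| => x _; rewrite pevalC.
- exists (M + 1) => x /DM; apply: le_trans; rewrite pevalX.
  rewrite [leRHS]/Num.norm/= mx_normrE; apply/bigmax_geP; right => /=.
  by exists (ord0, i).
- exists (Mp + Mq) => x Dx; rewrite pevalD.
  by rewrite (le_trans (ler_normD _ _))// lerD// ?Hp ?Hq.
- exists (Mp * Mq) => x Dx; rewrite pevalM normrM.
  by rewrite ler_pM// ?Hp ?Hq.
Qed.

Lemma is_derive_peval p (j : 'I_n) x :
  is_derive x (delta_mx ord0 j) (peval p) (peval (mderiv j p) x).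
Proof.
elim/mpoly_algebra_ind: p => [c|i|p q dp dq|p q dp dq].
- by rewrite pevalC mderivC /peval meval0; exact: is_derive_cst.
- rewrite pevalX mderivX /peval mevalZ mevalX mnm1E.
  have -> : (i == j)%:R * \prod_(l < n) x ord0 l ^+
      mnm_sub (mnm1 i) (mnm1 j) l = (i == j)%:R :> R.
    case: eqP => [->|_]; rewrite ?mul0r// mul1r big1// => l _.
    by rewrite mnmBE subnn expr0.
  (* The difference quotient of a coordinate is constant for h different from 0. *)
  have cv : h^-1 *: ((h *: delta_mx ord0 j + x : 'rV[R]_n) ord0 i - x ord0 i)
      @[h --> (0 : R)^'] --> ((i == j)%:R : R).
    apply: cvg_near_cst; near=> h.
    rewrite !mxE eqxx/= addrK /GRing.scale/= mulrA mulVf ?mul1r//.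
    near: h; exact: nbhs_dnbhs_neq.
  by apply: DeriveDef; [apply/cvg_ex; eexists; exact: cv | exact: cvg_lim].
- by rewrite mderivD !pevalD; exact: is_deriveD.
- rewrite mderivM pevalD !pevalM.
  by apply: is_derive_eq; rewrite /= addrC [X in X + _]mulrC.
Unshelve. all: by end_near. Qed.

(** A monomial m of the derivative comes from the monomial m + e_j of p, whose degree is one
    larger. *)
Lemma msize_mderiv p j k : (msize p <= k.+1)%N ->
  (msize (mderiv j p) <= k)%N.
Proof.
move=> pk; rewrite msizeE; apply/bigmax_leqP_seq => m + _.
rewrite mcoeff_msupp mcoeff_mderiv => h.
have : mnm_add m (mnm1 j) \in msupp p.
  by rewrite mcoeff_msupp; apply: contraNneq h => ->; rewrite mul0rn.
move/msize_mdeg_lt; rewrite mdegD mdeg1 addn1.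
by move/leq_trans => /(_ _ pk).
Qed.

End polynomial_functions.

(** * Lebesgue measure of open sets *)

Section lebesgue_rV.
Context {R : realType}.

(** The sup-norm ball written by coordinates: measurable as a finite intersection of preimages, and
    of product form under [cons_rV]. *)
Definition box n (x : 'rV[R]_n) (r : R) : set 'rV[R]_n :=
  [set y | forall i, ball (x ord0 i) r (y ord0 i)].

Lemma ball_box n (x : 'rV[R]_n) r : 0 < r -> ball x r = box x r.
Proof.
move=> r0; apply/seteqP; split => y /=; first by move=> [_ xy] i; exact: xy.
by move=> xy; split=> // i j; rewrite (ord1 i); exact: xy.
Qed.

Lemma measurable_box n (x : 'rV[R]_n) r : measurable (box x r).
Proof.
have -> : box x r =
    \bigcap_(i in [set: 'I_n]) ((fun y : 'rV[R]_n => y ord0 i) @^-1` ball (x ord0 i) r).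
  by apply/seteqP; split=> y xy i => [_|]; exact: xy.
apply: fin_bigcap_measurable => // i _.
by rewrite -[X in measurable X]setTI; apply: measurable_coord => //;
  exact: measurable_realfun.measurable_ball.
Qed.

(** Induction along the iterated product defining [leb]; in dimension 0 the Dirac mass gives 1, the
    empty power. *)
Lemma leb_box n (x : 'rV[R]_n) r : 0 < r -> leb R n (box x r) = ((r *+ 2) ^+ n)%:E.
Proof.
move=> r0; elim: n x => [|n IH] x.
  by rewrite /= diracE expr0 mem_set// => -[].
rewrite /= /leb_step /pushforward.
have -> : (@cons_rV R n) @^-1` box x r =
    ball (x ord0 ord0) r `*` box (uncons_rV x).2 r.
  apply/seteqP; split=> [[a y]|[a y] [/= xa xy]] /=.
    move=> xy; split=> [|i] /=; first by have := xy ord0; rewrite mxE unlift_none.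
    by have := xy (lift ord0 i); rewrite !mxE liftK.
  by move=> i; rewrite mxE; case: unliftP => [j|] -> //; have := xy j; rewrite mxE.
rewrite product_measure1E;
  [|exact: measurable_realfun.measurable_ball|exact: measurable_box].
by rewrite IH exprS EFinM; congr *%E; exact/lebesgue_measure_ball/ltW.
Qed.

(** The sigma-algebra is generated by coordinates, not by open sets, so an open set is written as a
    countable union of boxes with rational centres and radii 1/(k+1). *)
Lemma open_measurable_rV n (A : set 'rV[R]_n) : open A -> measurable A.
Proof.
move=> oA.
pose F (i : 'rV[rat]_n * nat) : set 'rV[R]_n :=
  let B := box (map_mx ratr i.1) i.2.+1%:R^-1 in
  if `[< B `<=` A >] then B else set0.
have -> : A = \bigcup_i F i.
  apply/seteqP; split=> [x Ax|x [i _]]; last first.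
    by rewrite /F; case: asboolP => // BA; exact: BA.
  have [e e0 xA] : exists2 e, 0 < e & ball x e `<=` A.
    by have /nbhs_ballP[e e0 eA] := open_nbhs_nbhs (conj oA Ax); exists e.
  (* A radius below e / 2 keeps a box that contains x inside the ball of radius e around x, by the
     triangle inequality. *)
  have [k ke] : exists k, (k.+1%:R^-1 : R) < e / 2.
    have /ltr_add_invr[k] : (0 : R) < e / 2 by rewrite divr_gt0.
    by rewrite add0r => h; exists k.
  have k0 : (0 : R) < k.+1%:R^-1 by rewrite invr_gt0.
  have /choice[q Hq] : forall i, exists q : rat, ball (ratr q : R) k.+1%:R^-1 (x ord0 i).
    move=> i; have [|q] := @rat_in_itvoo R (x ord0 i) (x ord0 i + k.+1%:R^-1).
      by rewrite ltrDl.
    rewrite in_itv/= => /andP[h1 h2]; exists q.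
    by rewrite /ball/= ltr_distl h2 andbT (lt_trans _ h1)// gtrBl.
  exists (\row_i q i, k) => //; rewrite /F /=; case: asboolP => [_|[]].
    by move=> i; rewrite !mxE; exact: Hq.
  move=> y yB; apply: xA; rewrite ball_box// => i.
  have := yB i; rewrite !mxE => h; have := ball_triangle (ball_sym (Hq i)) h.
  by apply: le_ball; rewrite (splitr e) lerD ?ltW.
apply: countable_bigcupT_measurable => [|i]; first exact: countableP.
by rewrite /F; case: asboolP => // _; exact: measurable_box.
Qed.

Section bounded_open.
Context {n : nat} (D : set 'rV[R]_n) (oD : open D) (bD : bounded_set D).
Implicit Types p : mpoly n R.

Lemma leb_bounded_fin : (leb R n D < +oo)%E.
Proof.
case: bD => M [_ DM].
have {}/DM DM : M < `|M| + 1 by rewrite (le_lt_trans (ler_norm M))// ltrDl.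
have r0 : 0 < `|M| + 2 :> R by rewrite ltr_pwDr.
(* D satisfies the large bound [|M| + 1]; one more unit makes it strict, as the open box
   requires. *)
apply: (@le_lt_trans _ _ (leb R n (box 0 (`|M| + 2)))); last by rewrite leb_box// ltry.
apply: le_measure; rewrite ?inE.
- exact: open_measurable_rV.
- exact: measurable_box.
- move=> x /DM xM; rewrite -ball_box// mx_norm_ball /ball_ /= sub0r normrN.
  by rewrite (le_lt_trans xM)// ltrD2l ltr1n.
Qed.

Lemma integrable_peval p : (leb R n).-integrable D (EFin \o peval p).
Proof.
apply: measurable_bounded_integrable.
- exact: open_measurable_rV.
- exact: leb_bounded_fin.
- exact: measurable_funTS (measurable_peval p).
- have [M HM] := peval_bounded p bD.
  exists M; split=> [|y My x Dx]; first exact: num_real.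
  exact: le_trans (HM _ Dx) (ltW My).
Qed.

(* A nonzero value of p persists on a small box, which has positive measure. *)
Lemma Rintegral_sqr_eq0 p : \int[leb R n]_(x in D) (peval (p * p) x) = 0 ->
  forall x, D x -> peval p x = 0.
Proof.
move=> I0 x Dx; apply/eqP/negPn/negP => px.
(* Half of the positive value at x: a lower bound that survives on a neighbourhood of x. *)
pose c := peval (p * p) x / 2.
have px0 : 0 < peval (p * p) x.
  by rewrite pevalM/= -expr2 exprn_even_gt0//= px.
have c0 : 0 < c by rewrite divr_gt0.
have : \forall y \near x, D y /\ c < peval (p * p) y.
  have cx : c < peval (p * p) x by rewrite /c ltr_pdivrMr// ltr_pMr// ltr1n.
  have h := cvgr_gt _ (@continuous_peval _ _ (p * p) x) _ cx.
  exact: filterI (open_nbhs_nbhs (conj oD Dx)) (h _).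
case/nbhs_ballP => e e0 eD; rewrite ball_box// in eD.
pose B := box x e.
have mB : measurable B by exact: measurable_box.
have BD : B `<=` D by move=> y /eD[].
have mD := open_measurable_rV oD.
have Bint : (leb R n).-integrable B (EFin \o peval (p * p)).
  by apply: integrableS BD _ => //; exact: integrable_peval.
(* The integral over D dominates c times the measure of the box, which is positive, against [I0]. *)
have : \int[leb R n]_(y in B) c <= \int[leb R n]_(y in D) (peval (p * p) y).
  apply: (@le_trans _ _ (\int[leb R n]_(y in B) (peval (p * p) y))).
    apply: le_Rintegral => //; last by move=> y /eD[_ /ltW].
    have := integrable_peval (mpolyC n c); rewrite pevalC.
    exact: integrableS.
  apply: fine_le.
  - exact: integrable_fin_num.
  - by apply: integrable_fin_num => //; exact: integrable_peval.
  - apply: ge0_subset_integral => //.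
    + apply/measurable_realfun.measurable_EFinP.
      exact: measurable_funTS (measurable_peval _).
    + by move=> y _; rewrite lee_fin pevalM/= -expr2 sqr_ge0.
rewrite I0 Rintegral_cst// leNgt mulr_gt0//.
apply: (@eq_ind_r _ _ (fun z => 0 < fine z) _ _ (leb_box x e0)) => /=.
by rewrite exprn_gt0// pmulrn_lgt0.
Qed.

End bounded_open.
End lebesgue_rV.

(** * Simplices and facets *)

Lemma open_finforall (V : topologicalType) (I : finType) (P : I -> set V) :
  (forall i, open (P i)) -> open [set x | forall i, P i x].
Proof.
move=> oP; rewrite openE => x Px; apply: filter_forall => i.
exact: open_nbhs_nbhs.
Qed.

Section affine_polynomials.
Context {R : realType}.

(** Barycentric coordinates, half-spaces and scalar products become polynomials, so their continuity
    follows from [continuous_peval]. *)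
Lemma affine_peval n (a : R) (c : 'I_n -> R) :
  exists p : mpoly n R, forall x, peval p x = a + \sum_i x ord0 i * c i.
Proof.
exists (mpolyC n a +
  \sum_i mpolyX R (mnm1 i) * mpolyC n (c i)) => x.
rewrite /peval mevalD mevalC raddf_sum; congr (_ + _).
by apply: eq_bigr => i _; rewrite /= mevalM mevalXU mevalC.
Qed.

(** Brings polynomials on a facet back to the reference simplex. The degree is not tracked: the
    pullback is only integrated. *)
Lemma peval_comp_affine m n (b : 'rV[R]_n) (A : 'M[R]_(m, n)) p :
  exists q, forall t, peval p (b + t *m A) = peval q t.
Proof.
elim/(@mpoly_algebra_ind R n): p => [c|i|p q [p' Hp] [q' Hq]|p q [p' Hp] [q' Hq]].
- by exists (mpolyC m c) => t; rewrite !pevalC.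
- have [q Hq] := affine_peval (b ord0 i) (A^~ i).
  by exists q => t; rewrite Hq pevalX !mxE.
- by exists (p' + q') => t; rewrite !pevalD/= Hp Hq.
- by exists (p' * q') => t; rewrite !pevalM/= Hp Hq.
Qed.

Lemma open_peval_gt0 n (p : mpoly n R) : open [set x | 0 < peval p x].
Proof.
have -> : [set x | 0 < peval p x] = peval p @^-1` [set r | 0 < r] by [].
by apply: open_comp => [x _|]; [exact: continuous_peval|exact: open_gt].
Qed.

Lemma open_reference_simplex n : open (@reference_simplex R n).
Proof.
apply: openI.
  apply: (@open_finforall _ _ (fun i => [set t : 'rV[R]_n | 0 < t ord0 i])) => i.
  by have := @open_peval_gt0 n (mpolyX R (mnm1 i)); rewrite pevalX.
have [p Hp] := @affine_peval n 1 (fun=> -1).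
rewrite (_ : (fun _ => _) = [set x | 0 < peval p x]); first exact: open_peval_gt0.
by apply/funext => t /=; rewrite Hp -mulr_suml mulrN1 subr_gt0.
Qed.

Lemma bounded_reference_simplex n : bounded_set (@reference_simplex R n).
Proof.
exists 1; split=> // M M1 t [t0 t1] /=.
rewrite [leLHS]/Num.norm/= mx_normrE; apply/bigmax_leP; split=> [|[i j] _] /=.
  by rewrite (le_trans ler01)// ltW.
rewrite (ord1 i) ger0_norm; last exact/ltW/t0.
apply/ltW/(lt_trans _ M1).
apply: le_lt_trans t1; rewrite (bigD1 j)//= lerDl sumr_ge0// => l _.
exact/ltW/t0.
Qed.

End affine_polynomials.

(** * Barycentric coordinates and openness of full-dimensional simplices *)

Section simplices.
Context {R : realType} {d : nat}.
Variable T : mesh R d.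
Implicit Types S F : {set 'I_(nnode T)}.

Lemma barycentric_uniq S (c c' : 'I_(nnode T) -> R) :
  affinely_independent S ->
  \sum_(i in S) c i = \sum_(i in S) c' i ->
  \sum_(i in S) c i *: node i = \sum_(i in S) c' i *: node i ->
  forall i, i \in S -> c i = c' i.
Proof.
move=> Sfree cc' cnode i iS; apply/eqP; rewrite -subr_eq0; apply/eqP.
apply: (Sfree (fun i => c i - c' i)) => //.
  by rewrite sumrB cc' subrr.
under eq_bigr do rewrite scalerBl.
by rewrite sumrB cnode subrr.
Qed.

(** Weights on a face F are extended by zero to S, so that weights on different faces can be
    compared in one simplex. *)
Lemma sum_subset (V : nmodType) F S (f : 'I_(nnode T) -> V) : F \subset S ->
  \sum_(i in S) (if i \in F then f i else 0) = \sum_(i in F) f i.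
Proof.
move=> FS; rewrite -big_mkcondr; apply: eq_bigl => i; apply: andb_idl.
by move/fintype.subsetP: FS; apply.
Qed.

Lemma sum_subset_node F S (c : 'I_(nnode T) -> R) : F \subset S ->
  \sum_(i in S) (if i \in F then c i else 0) *: node i =
  \sum_(i in F) c i *: node i.
Proof.
move=> FS; rewrite -(sum_subset _ FS); apply: eq_bigr => i _.
by case: ifP => // _; rewrite scale0r.
Qed.

Lemma affinely_independent_sub F S : F \subset S ->
  affinely_independent S -> affinely_independent F.
Proof.
move=> FS Sfree c c0 cn0 i iF.
have := Sfree (fun j => if j \in F then c j else 0).
rewrite sum_subset// sum_subset_node// => /(_ c0 cn0 i (fintype.subsetP FS _ iF)).
by rewrite iF.
Qed.

Lemma open_simplex_closed S : open_simplex S `<=` closed_simplex S.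
Proof. by move=> x [c [c0 c1 ->]]; exists c; split=> // i /c0/ltW. Qed.

Lemma open_open_simplex S : #|S| = d.+1 -> affinely_independent S ->
  open (open_simplex S).
Proof.
move=> cardS Sfree.
(* M sends barycentric coordinates to (1, x); x is in the open simplex iff its
   barycentric coordinates b x, which are affine in x, are positive. *)
pose M : 'M[R]_(#|S|, 1 + d) := \matrix_m row_mx 1 (node (enum_val m)).
have mulM (v : 'rV_#|S|) : v *m M =
    row_mx (\sum_m v ord0 m)%:M (\sum_m v ord0 m *: node (enum_val m)).
  apply/rowP => j; rewrite mxE; under eq_bigr do rewrite mxE.
  case: (split_ordP j) => {}j ->.
    rewrite row_mxEl (ord1 j) mxE mulr1n; apply: eq_bigr => m _.
    by rewrite row_mxEl mxE mulr1.
  rewrite row_mxEr summxE; apply: eq_bigr => m _.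
  by rewrite row_mxEr mxE.
(* Rows are indexed by ranks in S, whereas simplices use weights on all nodes; the sum below has at
   most one term and is 0 off S. *)
have coef (v : 'rV[R]_#|S|) :
    exists c : 'I_(nnode T) -> R, forall m : 'I_#|S|, c (enum_val m) = v ord0 m.
  exists (fun j => \sum_(m | enum_val m == j) v ord0 m) => m.
  by rewrite (big_pred1 m)// => m'; rewrite (inj_eq enum_val_inj).
have Mfree : row_free M.
  apply/inj_row_free => v; rewrite mulM -row_mx0 => /eq_row_mx[v0 vn].
  have [c Hc] := coef v; apply/rowP => m; rewrite -Hc mxE.
  apply: (Sfree c _ _ _ (enum_valP m)); rewrite big_enum_val/=.
    under eq_bigr do rewrite Hc; move/matrixP: v0 => /(_ ord0 ord0).
    by rewrite !mxE mulr1n.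
  by under eq_bigr do rewrite Hc.
(* M is square because S has d + 1 nodes; hence every row (1, x) has barycentric coordinates. *)
have Mfull : row_full M by rewrite /row_full (eqP Mfree) cardS.
pose b x := row_mx 1 x *m pinvmx M.
have bM x : b x *m M = row_mx 1 x by rewrite mulmxKpV// submx_full.
have bE x : \sum_m b x ord0 m = 1 /\
    \sum_m b x ord0 m *: node (enum_val m) = x.
  have := bM x; rewrite mulM => /eq_row_mx[/matrixP/(_ ord0 ord0) + ->].
  by rewrite !mxE eqxx !mulr1n.
have -> : open_simplex S = [set x | forall m, 0 < b x ord0 m].
  apply/seteqP; split=> x.
    move=> [c [c0 c1 cx]] m.
    have [c' Hc'] := coef (b x).
    rewrite -Hc' -(barycentric_uniq (c := c) Sfree) ?enum_valP//;
      first exact/c0/enum_valP.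
      rewrite c1 big_enum_val/=; under eq_bigr do rewrite Hc'.
      by have [->] := bE x.
    rewrite -cx big_enum_val/=; under eq_bigr do rewrite Hc'.
    by have [_ ->] := bE x.
  move=> bx; have [c Hc] := coef (b x); exists c; split.
  - move=> i iS; rewrite -(enum_rankK_in iS iS) Hc; exact: bx.
  - rewrite big_enum_val/=; under eq_bigr do rewrite Hc.
    by have [->] := bE x.
  - rewrite big_enum_val/=; under eq_bigr do rewrite Hc.
    by have [_ ->] := bE x.
apply: open_finforall => m.
have [p Hp] : exists p, forall x, peval p x = b x ord0 m.
  have [p Hp] := affine_peval (pinvmx M (lshift d ord0) m)
    (fun l => pinvmx M (rshift 1 l) m).
  exists p => x; rewrite Hp /b [RHS]mxE big_split_ord/= big_ord1.
  rewrite row_mxEl [X in _ = X * _ + _]mxE eqxx mul1r.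
  by congr (_ + _); apply: eq_bigr => l _; rewrite row_mxEr.
rewrite (_ : (fun _ => _) = [set x | 0 < peval p x]); first exact: open_peval_gt0.
by apply/funext => x /=; rewrite Hp.
Qed.

End simplices.

(** * The parametrization of a facet by the reference simplex *)

Section facets.
Context {R : realType} {d : nat}.
Variable T : mesh R d.+1.
Implicit Types F : {set 'I_(nnode T)}.

(** Weight s on vertex 0 and the i-th entry of t on vertex i + 1. Leaving s free covers both points,
    where the weights sum to 1, and combinations of edges, where they sum to 0. *)
Definition affine_weights (s : R) (t : 'rV[R]_d) (m : nat) : R :=
  if m is m'.+1 then oapp (fun i : 'I_d => t ord0 i) 0 (insub m') else s.

Lemma sum_affine_weights (V : lmodType R) s t (f : nat -> V) :
  \sum_(m < d.+1) affine_weights s t m *: f m =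
  s *: f 0%N + \sum_(i < d) t ord0 i *: f i.+1.
Proof.
rewrite big_ord_recl; congr (_ + _); apply: eq_bigr => i _.
by rewrite lift0 /= valK.
Qed.

Section facet.
Variables (F : {set 'I_(nnode T)}) (cardF : #|F| = d.+1).
Hypothesis Ffree : affinely_independent F.

Let rank j := index j (enum F).

Lemma big_facet (V : nmodType) (G : nat -> 'I_(nnode T) -> V) j0 :
  \sum_(j in F) G (rank j) j = \sum_(m < d.+1) G m (nth j0 (enum F) m).
Proof.
rewrite -big_enum (big_nth j0) -cardE cardF big_mkord; apply: eq_bigr => m _.
by rewrite /rank index_uniq ?enum_uniq// -cardE cardF.
Qed.

Lemma sum_facet (w : nat -> R) : \sum_(j in F) w (rank j) = \sum_(m < d.+1) w m.
Proof.
have [j0 _] : exists j, j \in F by apply/card_gt0P; rewrite cardF.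
exact: (big_facet (fun m _ => w m) j0).
Qed.

Lemma facet_nodeE j0 m : (m < d.+1)%N ->
  facet_node F m = node (nth j0 (enum F) m).
Proof. by move=> md; rewrite /facet_node (nth_map j0)// -cardE cardF. Qed.

Lemma sum_facet_node (w : nat -> R) :
  \sum_(j in F) w (rank j) *: node j = \sum_(m < d.+1) w m *: facet_node F m.
Proof.
have [j0 _] : exists j, j \in F by apply/card_gt0P; rewrite cardF.
rewrite (big_facet (fun m j => w m *: node j) j0).
by apply: eq_bigr => m _; rewrite (facet_nodeE j0).
Qed.

Lemma mul_facet_edges t : t *m facet_edges F =
  \sum_(m < d.+1) affine_weights (- \sum_i t ord0 i) t m *: facet_node F m.
Proof.
rewrite sum_affine_weights mulmx_sum_row scaleNr addrC scaler_suml -sumrB.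
by apply: eq_bigr => i _; rewrite rowK scalerBr.
Qed.

Lemma facet_paramE t : facet_param F t =
  \sum_(m < d.+1) affine_weights (1 - \sum_i t ord0 i) t m *: facet_node F m.
Proof.
rewrite /facet_param mul_facet_edges !sum_affine_weights addrA; congr (_ + _).
by rewrite scalerDl scale1r.
Qed.

Lemma sum_affine_weights1 s t :
  \sum_(m < d.+1) affine_weights s t m = s + \sum_i t ord0 i.
Proof.
have := sum_affine_weights s t (fun=> 1 : R^o).
under eq_bigr do rewrite /GRing.scale/= mulr1.
rewrite /GRing.scale/= mulr1 => ->; congr (_ + _).
by apply: eq_bigr => i _; rewrite mulr1.
Qed.

Lemma facet_param_open t : reference_simplex t -> open_simplex F (facet_param F t).
Proof.
move=> [t0 t1]; pose w := affine_weights (1 - \sum_i t ord0 i) t.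
exists (w \o rank); split=> [j jF||] /=.
- rewrite /w; have : (rank j < d.+1)%N by rewrite -cardF cardE index_mem mem_enum.
  case: (rank j) => [|m] /=; first by rewrite subr_gt0.
  by rewrite ltnS => md; rewrite insubT/=.
- by rewrite sum_facet sum_affine_weights1 subrK.
- by rewrite sum_facet_node facet_paramE.
Qed.

(** The parameters are the barycentric coordinates at all vertices but the first. This carries
    vanishing on the reference simplex back to the whole facet. *)
Lemma open_simplex_facet_param x : open_simplex F x ->
  exists2 t, reference_simplex t & x = facet_param F t.
Proof.
move=> [c [c0 c1 ->]].
have [j0 j0F] : exists j, j \in F by apply/card_gt0P; rewrite cardF.
pose w m := c (nth j0 (enum F) m).
have wc j : j \in F -> c j = w (rank j).
  by move=> jF; rewrite /w nth_index// mem_enum.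
pose t : 'rV[R]_d := \row_i w i.+1.
have w0 m : (m < d.+1)%N -> 0 < w m.
  by move=> md; apply: c0; rewrite -mem_enum mem_nth// -cardE cardF.
have w1 : w 0%N = 1 - \sum_i t ord0 i.
  rewrite -c1 (eq_bigr _ wc) sum_facet big_ord_recl.
  by under [X in _ - X]eq_bigr do rewrite mxE; rewrite addrK.
exists t.
  split=> [i|]; first by rewrite mxE w0// ltnS.
  by rewrite -subr_gt0 -w1 w0.
rewrite facet_paramE -w1 sum_affine_weights.
rewrite (eq_bigr (fun j => w (rank j) *: node j)); last by move=> j /wc ->.
rewrite sum_facet_node big_ord_recl; congr (_ + _).
by apply: eq_bigr => i _; rewrite mxE.
Qed.

(** A linear relation between edges is an affine relation between nodes, with weight minus the sum
    of the coefficients at vertex 0. *)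
Lemma row_free_facet_edges : row_free (facet_edges F).
Proof.
apply/inj_row_free => t; rewrite mul_facet_edges => t0.
set w := affine_weights _ _ in t0.
have [j0 j0F] : exists j, j \in F by apply/card_gt0P; rewrite cardF.
apply/rowP => i; rewrite mxE.
have := @Ffree (w \o rank); rewrite sum_facet_node t0 sum_facet sum_affine_weights1 addNr.
have iF : (i.+1 < #|F|)%N by rewrite cardF ltnS.
have nF : nth j0 (enum F) i.+1 \in F by rewrite -mem_enum mem_nth// -cardE.
move=> /(_ erefl erefl _ nF); rewrite /= /rank index_uniq ?enum_uniq -?cardE//.
by rewrite /w/= valK.
Qed.

End facet.

End facets.

Section euclidean.
Context {R : realType} {d : nat}.
Implicit Types u v : 'rV[R]_d.

Lemma dotv_mul u v : u *m v^T = (dotv u v)%:M.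
Proof.
apply/matrixP => i j; rewrite !ord1 !mxE mulr1n.
by apply: eq_bigr => l _; rewrite mxE.
Qed.

Lemma dotvv_ge0 u : 0 <= dotv u u.
Proof. by apply: sumr_ge0 => i _; rewrite -expr2 sqr_ge0. Qed.

Lemma dotvv_eq0 u : dotv u u = 0 -> u = 0.
Proof.
move/psumr_eq0P => u0; apply/rowP => i; rewrite mxE.
have /eqP := u0 (fun i _ => sqr_ge0 (u ord0 i)) i isT.
by rewrite mulf_eq0 orbb => /eqP.
Qed.

Lemma dotvZl a u v : dotv (a *: u) v = a * dotv u v.
Proof. by rewrite mulr_sumr; apply: eq_bigr => i _; rewrite mxE mulrA. Qed.

Lemma dotvDl u v w : dotv (u + v) w = dotv u w + dotv v w.
Proof. by rewrite -big_split; apply: eq_bigr => i _; rewrite mxE mulrDl. Qed.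

Lemma dotvZr a u v : dotv u (a *: v) = a * dotv u v.
Proof. by rewrite mulr_sumr; apply: eq_bigr => i _; rewrite mxE mulrCA. Qed.

End euclidean.

(* (1 - s) 1 + s A A^T is positive definite for s in [0, 1], so its determinant,
   a polynomial in s equal to 1 at 0, cannot change sign. *)
Lemma det_gram_gt0 {R : realType} m d (A : 'M[R]_(m, d)) :
  row_free A -> 0 < \det (A *m A^T).
Proof.
move=> Afree; set G := A *m A^T.
pose p : {poly R} := \det ((1 - 'X)%:M + 'X *: map_mx polyC G).
have pE s : p.[s] = \det ((1 - s)%:M + s *: G).
  rewrite -[LHS]/(horner_eval s p) -det_map_mx; congr (\det _).
  move: (G) => H; apply/matrixP => i j; rewrite !mxE /=.
  by rewrite horner_evalE hornerD hornerMn !hornerE.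
rewrite ltNge; apply/negP => G0.
(* [p] is 1 at 0 and, by [G0], at most 0 at 1; the intermediate value theorem is applied to [- p],
   which goes upwards. *)
have [||s s01] := @poly_ivt R (- p) 0 1; first exact: ler01.
  rewrite !hornerN !pE !subrr subr0 scale0r addr0 det1 scale1r.
  by rewrite (_ : 0%:M = 0) ?add0r ?oppr_le0 ?ler01 ?oppr_ge0 // raddf0.
rewrite rootN /root pE => /det0P[v v0].
(* Pairing the kernel vector with itself gives (1 - s) |v|^2 + s |v A|^2 = 0, so both terms vanish:
   s = 1 and v A = 0. *)
move/(congr1 (mulmx^~ v^T)).
rewrite mul0mx mulmxDr mulmxDl mul_mx_scalar -scalemxAl dotv_mul.
rewrite -scalemxAr -scalemxAl /G mulmxA -(mulmxA _ A^T) -trmx_mul dotv_mul.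
move/matrixP/(_ ord0 ord0); rewrite !mxE !mulr1n => /eqP.
have /andP[s0 s1] := s01.
rewrite paddr_eq0 ?mulr_ge0 ?dotvv_ge0 ?subr_ge0// !mulf_eq0 subr_eq0.
have vv : dotv v v == 0 = false by apply: contraNF v0 => /eqP/dotvv_eq0/eqP.
rewrite vv orbF => /andP[/eqP<-]; rewrite oner_eq0 => /eqP/dotvv_eq0/eqP.
by rewrite mulmx_free_eq0// (negPf v0).
Qed.

(** * Normals and triangulations of Lipschitz domains *)

Lemma cvg_segment_right {R : realType} {d} (x n : 'rV[R]_d) :
  x - t *: n @[t --> (0 : R)^'+] --> x.
Proof.
apply: cvg_at_right_filter.
have -> : nbhs x = nbhs (x - 0 *: n) by rewrite scale0r subr0.
by apply: cvgB; [exact: cvg_cst|apply: cvgZr_tmp; exact: cvg_id].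
Qed.

Section triangulations.
Context {R : realType} {d : nat}.
Variable T : mesh R d.+1.
Implicit Types (F : {set 'I_(nnode T)}) (e : 'I_(nel T)).

(** The d independent edges of F have an orthogonal complement of dimension 1, so n' = a n with a^2
    = 1. *)
Lemma unit_normal_uniq F (n n' : 'rV[R]_d.+1) :
  #|F| = d.+1 -> affinely_independent F ->
  dotv n n = 1 -> dotv n' n' = 1 ->
  (forall i j, i \in F -> j \in F -> dotv n (node i - node j) = 0) ->
  (forall i j, i \in F -> j \in F -> dotv n' (node i - node j) = 0) ->
  n' = n \/ n' = - n.
Proof.
move=> cardF Ffree n1 n'1 nF n'F.
have ker v : (forall i j, i \in F -> j \in F -> dotv v (node i - node j) = 0) ->
    (v <= kermx (facet_edges F)^T)%MS.
  move=> vF; apply/sub_kermxP/rowP => i; rewrite !mxE.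
  have [j0 _] : exists j, j \in F by apply/card_gt0P; rewrite cardF.
  have mem m : (m < d.+1)%N -> nth j0 (enum F) m \in F.
    by move=> md; rewrite -mem_enum mem_nth// -cardE cardF.
  rewrite -[RHS](vF (nth j0 (enum F) i.+1) (nth j0 (enum F) 0)); last 2 first.
  - by rewrite mem// ltnS.
  - exact: mem.
  apply: eq_bigr => l _.
  by rewrite !mxE !(facet_nodeE cardF j0)// ltnS.
have n0 : n != 0.
  by apply: contra_eq_neq n1 => ->; rewrite -(scale0r 0) dotvZl mul0r eq_sym oner_eq0.
have rker : \rank (kermx (facet_edges F)^T) = 1%N.
  rewrite mxrank_ker mxrank_tr (eqP (row_free_facet_edges cardF Ffree)).
  exact: subSnn.
have : (kermx (facet_edges F)^T <= n)%MS.
  by rewrite -(mxrank_leqif_sup (ker _ nF)) rker rank_rV n0.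
move/(submx_trans (ker _ n'F))/sub_rVP => [a n'a].
move: n'1; rewrite n'a dotvZl dotvZr n1 mulr1 => /eqP.
rewrite -expr2 sqrf_eq1 => /orP[]/eqP->; rewrite ?scale1r ?scaleN1r; by [left|right].
Qed.

Lemma open_simplex_neq0 F : F != finset.set0 -> open_simplex F !=set0.
Proof.
move=> F0; have cF : (0 : R) < #|F|%:R by rewrite ltr0n card_gt0.
exists (\sum_(i in F) #|F|%:R^-1 *: node i), (fun=> #|F|%:R^-1); split=> //.
  by move=> i _; rewrite invr_gt0.
by rewrite sumr_const -[LHS]mulr_natr mulVf// gt_eqF.
Qed.

(** With a common normal, the points x - t n for small t > 0 would lie in both sets. *)
Lemma outward_normals_disjoint (D D' : set 'rV[R]_d.+1) F n n' :
  F != finset.set0 -> outward_unit_normal D F n -> outward_unit_normal D' F n' ->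
  D `&` D' = set0 -> n' <> n.
Proof.
move=> /open_simplex_neq0[x Fx] [_ _ /(_ x Fx) Dn] [_ _ /(_ x Fx) Dn'] DD' nn'.
have [t [[Dt _] [D't _]]] := filter_ex (filterI Dn Dn').
have : (D `&` D') (x - t *: n) by split; rewrite // -nn'.
by rewrite DD'.
Qed.

(** With opposite normals, x - t n = x + t n' would be inside D and outside D'. *)
Lemma outward_normals_sub (D D' : set 'rV[R]_d.+1) F n n' :
  F != finset.set0 -> outward_unit_normal D F n -> outward_unit_normal D' F n' ->
  D `<=` D' -> n' <> - n.
Proof.
move=> /open_simplex_neq0[x Fx] [_ _ /(_ x Fx) Dn] [_ _ /(_ x Fx) Dn'] DD' nn'.
have [t [[/DD' D't _] [_ +]]] := filter_ex (filterI Dn Dn').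
by rewrite nn' scalerN.
Qed.

(** Makes the filter in [trace_from] proper at facet points, so that the trace is a genuine
    limit. *)
Lemma closure_outward_normal (D : set 'rV[R]_d.+1) F n x :
  outward_unit_normal D F n -> open_simplex F x -> closure D x.
Proof.
move=> [_ _ Dn] /Dn {}Dn B xB.
have [t [[Dt _] Bt]] := filter_ex (filterI Dn (@cvg_segment_right _ _ x n _ xB)).
by exists (x - t *: n).
Qed.

End triangulations.

(** * Lipschitz domains as interiors of their closures *)

Section lipschitz_domains.
Context {R : realType} {d : nat}.

Lemma continuous_dotv (v : 'rV[R]_d) : continuous (fun x : 'rV[R]_d => dotv x v).
Proof.
have [p Hp] := @affine_peval R d 0 (fun i => v ord0 i).
rewrite (_ : (fun x => dotv x v) = peval p); first exact: continuous_peval.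
by apply/funext => x; rewrite Hp add0r.
Qed.

(* Points just below the graph are exterior, so a boundary point is never
   interior to the closure. *)
Lemma lipschitz_open_closure (O U : set 'rV[R]_d) :
  lipschitz_boundary O -> open U -> U `<=` closure O -> U `<=` O.
Proof.
move=> lipO oU UO x Ux; apply: contrapT => nOx.
have [|nu [gam [nu1 lipg near]]] := lipO x.
  by split; [exact: UO|move=> /interior_subset].
have cg : continuous gam.
  move=> y; have [M [M0 HM]] := pinfty_ex_gt0 lipg.
  apply/(@cvgrPdist_lt _ _ _ (nbhs y)) => e e0; near=> z.
  apply: (le_lt_trans (HM (y, z) _)) => //=.
  rewrite -ltr_pdivlMl// mulrC; near: z.
  by apply: cvgr_dist_lt; rewrite ?divr_gt0//; exact: cvg_id.
(* The signed height below the graph: near x, membership in O means h < 0, hence h x >= 0. *)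
pose h y := gam (y - dotv y nu *: nu) - dotv y nu.
have cnu := @continuous_dotv nu.
have cproj : continuous (fun y : 'rV[R]_d => y - dotv y nu *: nu).
  move=> y; have cZ : dotv z nu *: nu @[z --> y] --> dotv y nu *: nu.
    exact: (@cvgZr_tmp _ _ _ (nbhs y) _ _ _ nu (cnu y)).
  exact: (cvgB cvg_id cZ).
have ch : continuous h.
  move=> y; have cgp := continuous_comp (cproj y) (cg _).
  exact: (cvgB cgp (cnu y)).
have nU : nbhs x ([set y | O y <-> h y < 0] `&` U)°.
  apply: nbhs_interior; apply: filterI; last exact: open_nbhs_nbhs.
  by apply: filterS near => z /=; rewrite /h subr_lt0.
have segU : \forall t \near (0 : R)^'+, ([set y | O y <-> h y < 0] `&` U)° (x - t *: nu).
  exact: cvg_segment_right nU.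
have [t [yU t0]] := filter_ex (filterI segU (nbhs_right_gt 0)).
set y := x - t *: nu in yU.
have hy : 0 < h y.
  have hx : 0 <= h x.
    by rewrite leNgt subr_lt0; apply/negP => /(nbhs_singleton near).
  (* Moving by - t nu keeps the projection and lowers the height by t, so h grows by t and becomes
     positive. *)
  have ynu : dotv y nu = dotv x nu - t.
    by rewrite /y -scaleNr dotvDl dotvZl nu1 mulr1.
  rewrite /h ynu (_ : y - _ = x - dotv x nu *: nu).
    by rewrite opprB addrCA ltr_pwDl.
  by rewrite /y scalerBl opprB addrA subrK.
have : closure O y by apply: UO; have [] := interior_subset yU.
(* A point of O close enough to y would have h both negative and positive. *)
move=> /(_ _ (filterI yU (ch y _ (open_nbhs_nbhs (conj (@open_gt R 0) hy))))).
by move=> [z [Oz [[/= zP _] hz]]]; have := zP.1 Oz; rewrite ltNge ltW.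
Unshelve. all: by end_near. Qed.

End lipschitz_domains.

(** * Elements, facets and normals of a triangulated domain *)

Section triangulated_domain.
Context {R : realType} {d : nat}.
Variables (T : mesh R d.+1) (O : set 'rV[R]_d.+1).
Hypotheses (hO : bounded_lipschitz_domain O) (hT : triangulation T O).
Implicit Types (F G S : {set 'I_(nnode T)}) (e : 'I_(nel T)).

Lemma elt_facetP e F : F \in elt_facets e ->
  [/\ F \subset elt e, #|F| = d.+1 & affinely_independent F].
Proof.
case: hT => /(_ e)[cardE Efree] _ _ _ /imsetP[i ie ->].
have sub : elt e :\ i \subset elt e by exact: subD1set.
split=> //; last exact: affinely_independent_sub sub Efree.
by have := cardsD1 i (elt e); rewrite ie cardE => -[].
Qed.

Lemma elt_facet_neq0 e F : F \in elt_facets e -> F != finset.set0.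
Proof. by move=> /elt_facetP[_ cF _]; rewrite -card_gt0 cF. Qed.

Lemma open_element e : open (element e).
Proof. by case: hT => /(_ e)[cE Efree] _ _ _; exact: open_open_simplex. Qed.

Lemma element_sub e : element e `<=` O.
Proof.
case: hO => _ _ _ _ lipO; apply: (lipschitz_open_closure lipO (@open_element e)).
by case: hT => _ -> _ _ x /open_simplex_closed xe; exists e.
Qed.

Lemma element_bounded e : bounded_set (element e).
Proof.
case: hO => _ _ _ [M [Mreal OM]] _; exists M; split=> // y /OM {}OM x /element_sub.
exact: OM.
Qed.

Lemma disjoint_elements e e' : e != e' -> element e `&` element e' = set0.
Proof. by case: hT => _ _ + _; apply. Qed.

(** Extended by zero to S, the two weight families of x coincide, and those of F are positive on
    F. *)
Lemma barycentric_support S F G x : affinely_independent S ->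
  F \subset S -> G \subset S -> open_simplex F x -> closed_simplex G x -> F \subset G.
Proof.
move=> Sfree FS GS [a [a0 a1 xa]] [b [b0 b1 xb]].
pose ea i := if i \in F then a i else 0; pose eb i := if i \in G then b i else 0.
have eab : forall i, i \in S -> ea i = eb i.
  apply: barycentric_uniq => //; first by rewrite !sum_subset// a1.
  by rewrite !sum_subset_node// -xa.
apply/fintype.subsetP => i iF; have := eab i (fintype.subsetP FS _ iF).
rewrite /ea /eb iF; case: ifP => // _ ai0.
by have := a0 i iF; rewrite ai0 ltxx.
Qed.

Lemma closed_simplex_subset F S : F \subset S ->
  closed_simplex F `<=` closed_simplex S.
Proof.
move=> FS x [a [a0 a1 ->]].
exists (fun i => if i \in F then a i else 0); split.
- by move=> i _; case: ifP => // /a0.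
- by rewrite sum_subset.
- by rewrite sum_subset_node.
Qed.

(** A common point lies in both closed elements, hence, by conformity of the mesh, in the simplex on
    their common nodes. This puts G inside [elt e], where F and G have the same support. *)
Lemma open_facets_disjoint F G x : F \in facets T -> G \in facets T ->
  open_simplex F x -> open_simplex G x -> F = G.
Proof.
move=> /bigcupP[e _ Fe] /bigcupP[e' _ Ge'] Fx Gx.
have [Fsub _ _] := elt_facetP Fe; have [Gsub _ _] := elt_facetP Ge'.
case: hT => Tfree _ _ /(_ e e') cap.
have [_ efree] := Tfree e; have [_ e'free] := Tfree e'.
have Fxc := open_simplex_closed Fx; have Gxc := open_simplex_closed Gx.
have xcap : closed_simplex (elt e :&: elt e') x.
  by rewrite -cap; split;
    [apply: closed_simplex_subset Fxc|apply: closed_simplex_subset Gxc].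
have Gee' : G \subset elt e :&: elt e'.
  exact: (barycentric_support e'free Gsub (subsetIr _ _) Gx xcap).
have Gsub' : G \subset elt e := fintype.subset_trans Gee' (subsetIl _ _).
apply/eqP; rewrite finset.eqEsubset; apply/andP; split.
- exact: (barycentric_support efree Fsub Gsub' Fx Gxc).
- exact: (barycentric_support efree Gsub' Fsub Gx Fxc).
Qed.

Section normals.
Variable n : 'I_(nel T) -> {set 'I_(nnode T)} -> 'rV[R]_d.+1.
Hypothesis hn : forall e F, F \in elt_facets e ->
  outward_unit_normal (element e) F (n e F).

Lemma normal_opp F e e' : e != e' -> F \in elt_facets e -> F \in elt_facets e' ->
  n e' F = - n e F.
Proof.
move=> ee' Fe Fe'; have [_ cF Ffree] := elt_facetP Fe.
have [n1 nF _] := hn Fe; have [n1' nF' _] := hn Fe'.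
have [nn'|//] := unit_normal_uniq cF Ffree n1 n1' nF nF'.
case: (outward_normals_disjoint (elt_facet_neq0 Fe) (hn Fe) (hn Fe')) => //.
exact: disjoint_elements.
Qed.

(** The normal of a third element would be opposite to those of e and e', making these equal
    although they are opposite. *)
Lemma facet_two_elements F e e' e'' : e != e' -> F \in elt_facets e ->
  F \in elt_facets e' -> F \in elt_facets e'' -> (e'' == e) || (e'' == e').
Proof.
move=> ee' Fe Fe' Fe''; apply/norP => -[e''e e''e'].
have h1 := normal_opp ee' Fe Fe'.
have h2 := normal_opp e''e Fe'' Fe.
have h3 := normal_opp e''e' Fe'' Fe'.
have [n1 _ _] := hn Fe.
have : dotv (n e' F) (n e F) = 1 by rewrite h3 -h2.
rewrite h1 -scaleN1r dotvZl n1 mulr1 => /eqP.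
by rewrite lt_eqF// (@lt_trans _ _ 0)// ltrN10.
Qed.

Section boundary.
Variable nO : {set 'I_(nnode T)} -> 'rV[R]_d.+1.
Hypothesis hnO : forall F, F \in boundary_facets T O ->
  outward_unit_normal O F (nO F).

Lemma boundary_normal F e : F \in boundary_facets T O -> F \in elt_facets e ->
  nO F = n e F.
Proof.
move=> FO Fe; have [_ cF Ffree] := elt_facetP Fe.
have [n1 nF _] := hn Fe; have [n1' nF' _] := hnO FO.
have [//|nn'] := unit_normal_uniq cF Ffree n1 n1' nF nF'.
case: (outward_normals_sub (elt_facet_neq0 Fe) (hn Fe) (hnO FO)) => //.
exact: element_sub.
Qed.

Lemma boundary_facet_element F e e' : F \in boundary_facets T O ->
  F \in elt_facets e -> F \in elt_facets e' -> e' = e.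
Proof.
move=> FO Fe Fe'; apply/eqP; rewrite eq_sym; apply/negPn/negP => ee'.
have := outward_normals_disjoint (elt_facet_neq0 Fe) (hn Fe) (hn Fe').
move=> /(_ (disjoint_elements ee')).
by rewrite -(boundary_normal FO Fe) -(boundary_normal FO Fe').
Qed.

End boundary.
End normals.
End triangulated_domain.

(** * Testing the divergence and flux equations *)

Lemma L2_restrict {R : realType} {d} (D E : set 'rV[R]_d) p :
  open D -> open E -> bounded_set E -> L2 D (peval p \_ E).
Proof.
move=> oD oE bE; have mD := open_measurable_rV oD; have mE := open_measurable_rV oE.
split.
  apply: measurable_funTS; apply/(measurable_restrictT _ mE).
  exact: measurable_funTS (measurable_peval p).
(* Integrability is obtained on the whole space, where the squared zero extension is the zero
   extension of [p * p], then restricted to D. *)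
apply: (@integrableS _ _ _ _ setT) => //.
have := integrable_peval oE bE (p * p).
move/(integrable_mkcond _ mE); apply: eq_integrable => // x _ /=.
by rewrite !patchE; case: ifP => _; rewrite ?expr0n//= pevalM.
Qed.

Lemma cvg_row_peval {R : realType} {m n} (P : 'I_n -> mpoly m R) :
  continuous (fun x => \row_j peval (P j) x : 'rV[R]_n).
Proof.
move=> x A [B nB BA].
have : \forall y \near x, forall j, B ord0 j (peval (P j) y).
  apply: (@filter_forall _ _ (fun j y => B ord0 j (peval (P j) y)) (nbhs x)) => j.
  have := nB ord0 j; rewrite mxE.
  exact: continuous_peval.
by apply: filterS => y yB; apply: BA => i j; rewrite (ord1 i) mxE; exact: yB.
Qed.

(** Computes traces: inside D the function is polynomial, and the polynomial is continuous up to the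
    boundary. *)
Lemma lim_within_peval {R : realType} {d m} (D : set 'rV[R]_d)
    (u : 'rV[R]_d -> 'rV[R]_m) (P : 'I_m -> mpoly d R) x :
  (forall j y, D y -> u y ord0 j = peval (P j) y) -> closure D x ->
  lim (u @ within D (nbhs x)) = \row_j peval (P j) x.
Proof.
move=> uP Dx; have FF := @within_nbhs_proper _ D x Dx.
apply: cvg_lim; first exact: norm_hausdorff.
apply: (@cvg_trans _ (fmap (fun y => \row_j peval (P j) y) (within D (nbhs x)))).
  apply: (@fmap_within_eq _ D _ (nbhs x)) => y /set_mem Dy.
  by apply/rowP => j; rewrite mxE uP.
exact: (@cvg_within_filter _ _ _ (nbhs x) _ _ D (@cvg_row_peval _ _ _ P x)).
Qed.

(** * Facet integrals of polynomials *)

Section facet_integrals.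
Context {R : realType} {d : nat}.
Variable T : mesh R d.+1.
Variables (F : {set 'I_(nnode T)}) (cardF : #|F| = d.+1).
Hypothesis Ffree : affinely_independent F.

Lemma eq_facet_integral f g : (forall x, open_simplex F x -> f x = g x) ->
  facet_integral F f = facet_integral F g.
Proof.
move=> fg; congr (_ * _); apply: eq_Rintegral => t /set_mem tref.
by apply: fg; exact: facet_param_open.
Qed.

Lemma facet_integral0 f : (forall x, open_simplex F x -> f x = 0) ->
  facet_integral F f = 0.
Proof.
move=> f0; rewrite (eq_facet_integral (g := fun=> 0))// /facet_integral Rintegral_cst.
  by rewrite mul0r mulr0.
exact: (open_measurable_rV (@open_reference_simplex R d)).
Qed.

Let pull p : {q | forall t, peval p (facet_param F t) = peval q t}.
Proof. exact/cid/peval_comp_affine. Qed.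

Lemma integrable_facet p : (leb R d).-integrable (@reference_simplex R d)
  (EFin \o (fun t => peval p (facet_param F t))).
Proof.
have [q Hq] := pull p.
rewrite (_ : EFin \o _ = EFin \o peval q); last by apply/funext => t /=; rewrite Hq.
apply: integrable_peval; first exact: open_reference_simplex.
exact: bounded_reference_simplex.
Qed.

Lemma facet_integralD p q : facet_integral F (peval (p + q)) =
  facet_integral F (peval p) + facet_integral F (peval q).
Proof.
rewrite /facet_integral -mulrDr; congr (_ * _).
rewrite -RintegralD ?pevalD//; [|exact: integrable_facet|exact: integrable_facet].
exact: (open_measurable_rV (@open_reference_simplex R d)).
Qed.

Lemma facet_integralZ a p :
  facet_integral F (peval (a *: p)) = a * facet_integral F (peval p).
Proof.
rewrite /facet_integral mulrCA; congr (_ * _).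
rewrite -RintegralZl ?pevalZ//; last exact: integrable_facet.
exact: (open_measurable_rV (@open_reference_simplex R d)).
Qed.

(** The area factor is positive because the edges are independent; dividing it out leaves the
    integral of a square over the reference simplex. *)
Lemma facet_integral_sqr_eq0 p : facet_integral F (peval (p * p)) = 0 ->
  forall x, open_simplex F x -> peval p x = 0.
Proof.
have [q Hq] := pull p.
have area : Num.sqrt (\det (facet_edges F *m (facet_edges F)^T)) != 0.
  rewrite gt_eqF// sqrtr_gt0; apply: det_gram_gt0.
  exact: row_free_facet_edges.
move/eqP; rewrite mulf_eq0 (negPf area) => /eqP I0 x.
move=> /(open_simplex_facet_param cardF)[t tref ->]; rewrite Hq.
apply: Rintegral_sqr_eq0 tref;
  [exact: open_reference_simplex|exact: bounded_reference_simplex|].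
rewrite -I0; apply: eq_Rintegral => s _.
by rewrite !pevalM/= Hq.
Qed.

Lemma L2_facet_peval f p : (forall x, open_simplex F x -> f x = peval p x) ->
  L2_facet F f.
Proof.
move=> fp; have [q Hq] := pull p.
have E : {in @reference_simplex R d, peval q =1 f \o facet_param F}.
  by move=> t /set_mem tref; rewrite /= fp -?Hq//; exact: facet_param_open.
split.
  by apply: (eq_measurable_fun _ E); exact: measurable_funTS (measurable_peval q).
have mref := open_measurable_rV (@open_reference_simplex R d).
have := integrable_peval (@open_reference_simplex R d)
  (@bounded_reference_simplex R d) (q * q).
by apply: eq_integrable => // t tref /=; rewrite pevalM /= E.
Qed.

End facet_integrals.

(** * Exact conservation: divergence, jumps and boundary fluxes *)

Section conservation.
Context {R : realType} {d : nat}.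
Variables (T : mesh R d.+1) (O : set 'rV[R]_d.+1).
Hypotheses (hO : bounded_lipschitz_domain O) (hT : triangulation T O).
Variables (k : nat) (rho : R).
Hypotheses (hk : (1 <= k)%N) (hrho : 0 < rho).
Variable u : 'rV[R]_d.+1 -> 'rV[R]_d.+1.
Hypothesis hu : Vh T k O u.

Lemma Vh_peval : exists P : 'I_(nel T) -> 'I_d.+1 -> mpoly d.+1 R,
  forall e j, (msize (P e j) <= k.+1)%N /\
    forall x, element e x -> u x ord0 j = peval (P e j) x.
Proof.
have /choice[P HP] : forall ej : 'I_(nel T) * 'I_d.+1,
    exists p : mpoly d.+1 R, (msize p <= k.+1)%N /\
      forall x, element ej.1 x -> u x ord0 ej.2 = peval p x.
  by move=> [e j]; have [_ /(_ e)[p Hp]] := hu j; exists p.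
by exists (fun e j => P (e, j)) => e j; exact: (HP (e, j)).
Qed.

Section polynomial_representative.
Variable P : 'I_(nel T) -> 'I_d.+1 -> mpoly d.+1 R.
Hypothesis HP : forall e j, (msize (P e j) <= k.+1)%N /\
  forall x, element e x -> u x ord0 j = peval (P e j) x.

Definition div_poly e := \sum_j mderiv j (P e j).

Lemma divergence_peval e x : element e x -> divergence u x = peval (div_poly e) x.
Proof.
move=> ex; rewrite peval_sum; apply: eq_bigr => j _.
(* The element is open, so u agrees with its polynomial near x and has the same derivatives
   there. *)
have DE : \forall y \near x, coordf u j y = peval (P e j) y.
    apply: filterS (open_nbhs_nbhs (conj (@open_element _ _ _ _ hT e) ex)) => y ey.
    by have [_] := HP e j; exact.
  have -> : 'D_(delta_mx ord0 j) (coordf u j) x = 'D_(delta_mx ord0 j) (peval (P e j)) x.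
  exact: near_eq_derive.
by have [] := is_derive_peval (P e j) j x.
Qed.

Lemma divergence_free :
  (forall q, Qh T k O q -> \sum_(e < nel T)
     \int[leb R d.+1]_(x in element e) (rho^-1 * divergence u x * q x) = 0) ->
  forall (e : 'I_(nel T)) x, element e x -> divergence u x = 0.
Proof.
move=> hdiv e x ex.
have oe (e' : 'I_(nel T)) : open (element e') := @open_element _ _ _ _ hT e'.
have be (e' : 'I_(nel T)) : bounded_set (element e').
  exact: (element_bounded hO hT).
have me e' := open_measurable_rV (oe e').
pose q := peval (div_poly e) \_ (element e).
have qQ : Qh T k O q.
  split; first by apply: L2_restrict => //; case: hO.
  move=> e'; have [->|ee'] := eqVneq e' e.
    exists (div_poly e); split.
      (* The degree bound of [Qh] reads [k.-1.+1], which is k because k >= 1; differentiation lowers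
         the size from k + 1 to k. *)
      rewrite prednK//; apply: msize_sum_le => j; apply: msize_mderiv.
      by have [] := HP e j.
    by move=> y ey; rewrite /q patchE mem_set.
  exists 0; split; first by rewrite msize0.
  move=> y ey; rewrite /q patchE memNset ?meval0// => e'y.
  have : (element e' `&` element e) y by [].
  by rewrite (disjoint_elements hT).
have := hdiv q qQ; rewrite (bigD1 e)//= [X in _ + X]big1 ?addr0 => [|e' ee']; last first.
  rewrite (@eq_Rintegral _ _ _ _ _ (fun=> 0)); first by rewrite Rintegral_cst// mul0r.
  move=> y /set_mem ey; rewrite /q patchE memNset ?mulr0// => e'y.
  have : (element e' `&` element e) y by [].
  by rewrite (disjoint_elements hT).
rewrite (@eq_Rintegral _ _ _ _ _
  (fun y => rho^-1 * peval (div_poly e * div_poly e) y)); last first.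
  move=> y /[dup] ye /set_mem ey.
  by rewrite (divergence_peval ey) /q patchE ye pevalM mulrA.
rewrite RintegralZl//; last exact: integrable_peval.
move/eqP; rewrite mulf_eq0 invr_eq0 gt_eqF//= => /eqP I0.
rewrite (divergence_peval ex); exact: (Rintegral_sqr_eq0 (oe e) (be e) I0).
Qed.

Variable n : 'I_(nel T) -> {set 'I_(nnode T)} -> 'rV[R]_d.+1.
Hypothesis hn : forall e F, F \in elt_facets e ->
  outward_unit_normal (element e) F (n e F).
Variable nO : {set 'I_(nnode T)} -> 'rV[R]_d.+1.
Hypothesis hnO : forall F, F \in boundary_facets T O -> outward_unit_normal O F (nO F).
Variable uhat : 'rV[R]_d.+1 -> 'rV[R]_d.+1.
Hypothesis huhat : Vhat T k uhat.
Hypothesis hflux : forall qhat, Qhat T k qhat ->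
  \sum_(e < nel T) \sum_(F in elt_facets e)
    facet_integral F (fun x =>
      rho^-1 * dotv (trace_from e u x) (n e F) * qhat x)
  - \sum_(F in boundary_facets T O)
    facet_integral F (fun x =>
      rho^-1 * dotv (uhat x) (nO F) * qhat x) = 0.

(** The component along a constant vector: the normal is constant on a facet, so the degree does not
    increase. *)
Definition dot_poly (p : 'I_d.+1 -> mpoly d.+1 R) (v : 'rV[R]_d.+1) :=
  \sum_j v ord0 j *: p j.

Lemma peval_dot_poly p v x : peval (dot_poly p v) x = dotv (\row_j peval (p j) x) v.
Proof. by rewrite peval_sum; apply: eq_bigr => j _; rewrite pevalZ mxE mulrC. Qed.

Lemma msize_dot_poly p v m : (forall j, (msize (p j) <= m)%N) ->
  (msize (dot_poly p v) <= m)%N.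
Proof.
by move=> pm; apply: msize_sum_le => j; apply: leq_trans (msizeZ_le _ _) (pm j).
Qed.

Lemma trace_peval e F x v : F \in elt_facets e -> open_simplex F x ->
  dotv (trace_from e u x) v = peval (dot_poly (P e) v) x.
Proof.
move=> Fe Fx; rewrite peval_dot_poly /trace_from.
rewrite (@lim_within_peval _ _ _ _ _ (P e))//.
  by move=> j y ey; have [_ ->] := HP e j.
exact: closure_outward_normal (hn Fe) Fx.
Qed.

Lemma facets_elt e F : F \in elt_facets e -> F \in facets T.
Proof. by move=> Fe; apply/bigcupP; exists e. Qed.

Lemma facet_card F : F \in facets T -> #|F| = d.+1 /\ affinely_independent F.
Proof. by move=> /bigcupP[e _ /(elt_facetP hT)[]]. Qed.

(** Localizes the flux equation to F by extending g by zero to the other facets; the traces turn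
    into polynomials, while [uhat] is kept as a function. *)
Lemma flux_test F g : F \in facets T -> (msize g <= k.+1)%N ->
  \sum_(e < nel T | F \in elt_facets e)
    facet_integral F (peval (rho^-1 *: (dot_poly (P e) (n e F) * g)))
  - (if F \in boundary_facets T O then
      facet_integral F (fun x => rho^-1 * dotv (uhat x) (nO F) * peval g x) else 0)
  = 0.
Proof.
move=> FT gk; pose q := peval g \_ (open_simplex F).
have qE x : open_simplex F x -> q x = peval g x.
  by move=> Fx; rewrite /q patchE mem_set.
(* Distinct open facets are disjoint, so the extension is unambiguous and vanishes on every other
   facet. *)
have q0 G x : G \in facets T -> G != F -> open_simplex G x -> q x = 0.
  move=> GT GF Gx; rewrite /q patchE memNset// => Fx.
  by move/eqP: GF; apply; exact: (open_facets_disjoint hT GT FT Gx Fx).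
have qQ : Qhat T k q.
  split=> G GT; have [cG Gfree] := facet_card GT; have [GF|GF] := eqVneq G F.
  - by rewrite GF in cG *; apply: (L2_facet_peval cG (p := g)).
  - apply: (L2_facet_peval cG (p := 0)) => x Gx.
    by rewrite (q0 G) /peval ?meval0.
  - by exists g; split=> // x; rewrite GF; exact: qE.
  - exists 0; split=> [|x Gx]; first by rewrite msize0.
    by rewrite (q0 G) ?meval0.
rewrite -[RHS](hflux qQ); congr (_ - _).
  rewrite big_mkcond/=; apply: eq_bigr => e _.
  have z G : G \in elt_facets e -> G != F -> facet_integral G (fun x =>
      rho^-1 * dotv (trace_from e u x) (n e G) * q x) = 0.
    move=> Ge GF; have GT := facets_elt Ge; have [cG _] := facet_card GT.
    by apply: facet_integral0 => // x Gx; rewrite (q0 G)// mulr0.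
  case: ifPn => Fe; last first.
    by rewrite big1// => G Ge; apply: z => //; apply: contraNneq Fe => <-.
  rewrite (bigD1 F)//= big1 ?addr0 => [|G /andP[Ge GF]]; last exact: z.
  have [cF _] := facet_card FT; apply: eq_facet_integral => // x Fx.
  by rewrite pevalZ pevalM/= (trace_peval _ Fe Fx) qE// mulrA.
have bT G : G \in boundary_facets T O -> G \in facets T.
  by rewrite inE => /andP[].
have z G : G \in boundary_facets T O -> G != F -> facet_integral G (fun x =>
    rho^-1 * dotv (uhat x) (nO G) * q x) = 0.
  move=> GO GF; have GT := bT _ GO; have [cG _] := facet_card GT.
  by apply: facet_integral0 => // x Gx; rewrite (q0 G)// mulr0.
case: ifPn => FO; last first.
  by rewrite big1// => G GO; apply: z => //; apply: contraNneq FO => <-.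
rewrite (bigD1 F)//= big1 ?addr0 => [|G /andP[GO GF]]; last exact: z.
have [cF _] := facet_card FT; apply: eq_facet_integral => // x Fx.
by rewrite qE.
Qed.

(** The test function g is the jump itself; exactly two elements contribute to [flux_test], and
    there is no boundary term. *)
Lemma jump_eq0 F e e' x : e != e' -> F \in elt_facets e -> F \in elt_facets e' ->
  open_simplex F x -> jump n F e e' u x = 0.
Proof.
move=> ee' Fe Fe' Fx; have FT := facets_elt Fe; have [cF Ffree] := facet_card FT.
pose N e := dot_poly (P e) (n e F); pose g := N e + N e'.
rewrite /jump (trace_peval _ Fe Fx) (trace_peval _ Fe' Fx).
have gE : peval g x = peval (N e) x + peval (N e') x by rewrite pevalD.
rewrite -gE; apply: (facet_integral_sqr_eq0 cF Ffree _ Fx).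
have Nk e0 : (msize (N e0) <= k.+1)%N.
  by apply: msize_dot_poly => j; have [] := HP e0 j.
have gk : (msize g <= k.+1)%N.
  by rewrite (leq_trans (msizeD_le _ _))// geq_max !Nk.
have := flux_test FT gk.
rewrite ifN; last first.
  apply: contraNN ee' => FO.
  by rewrite (boundary_facet_element hO hT hn hnO FO Fe Fe').
rewrite subr0 (bigD1 e)//= (bigD1 e')/=; last by rewrite Fe' eq_sym.
rewrite big1 ?addr0 => [|e0 /andP[/andP[Fe0 e0e] e0e']]; last first.
  have := facet_two_elements hT hn ee' Fe Fe' Fe0.
  by rewrite (negPf e0e) (negPf e0e').
rewrite -facet_integralD// -scalerDr -mulrDl facet_integralZ//.
by move/eqP; rewrite mulf_eq0 invr_eq0 gt_eqF//= => /eqP.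
Qed.

(** The test function is the difference of the two normal components; only e contributes besides the
    boundary term. *)
Lemma boundary_flux F e x : F \in boundary_facets T O -> F \in elt_facets e ->
  open_simplex F x -> dotv (trace_from e u x) (nO F) = dotv (uhat x) (nO F).
Proof.
move=> FO Fe Fx; have FT := facets_elt Fe; have [cF Ffree] := facet_card FT.
have /choice[Ph HPh] : forall j, exists p : mpoly d.+1 R,
    (msize p <= k.+1)%N /\ forall x, open_simplex F x -> uhat x ord0 j = peval p x.
  by move=> j; have [_ /(_ F FT)] := huhat j.
pose N := dot_poly (P e) (nO F); pose B := dot_poly Ph (nO F).
have BE y : open_simplex F y -> dotv (uhat y) (nO F) = peval B y.
  move=> Fy; rewrite peval_dot_poly; congr dotv; apply/rowP => j.
  by rewrite mxE; have [_ ->] := HPh j.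
pose g := N + (-1) *: B.
rewrite (trace_peval _ Fe Fx) BE//; apply/eqP; rewrite -subr_eq0.
have gE : peval g x = peval N x - peval B x by rewrite pevalD/= pevalZ mulN1r.
rewrite -gE; apply/eqP; apply: (facet_integral_sqr_eq0 cF Ffree _ Fx).
have gk : (msize g <= k.+1)%N.
  rewrite (leq_trans (msizeD_le _ _))// geq_max msize_dot_poly/=; last first.
    by move=> j; have [] := HP e j.
  rewrite (leq_trans (msizeZ_le _ _))// msize_dot_poly// => j.
  by have [] := HPh j.
have := flux_test FT gk; rewrite FO (bigD1 e)//= big1 ?addr0; last first.
  move=> e0 /andP[Fe0 /eqP e0e]; case: e0e.
  exact: (boundary_facet_element hO hT hn hnO FO Fe Fe0).
(* With a single normal for both integrals, their difference becomes the integral of [g * g] scaled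
   by [rho^-1]. *)
rewrite -(boundary_normal hO hT hn hnO FO Fe).
have -> : facet_integral F (fun y => rho^-1 * dotv (uhat y) (nO F) * peval g y) =
    facet_integral F (peval (rho^-1 *: (B * g))).
  by apply: eq_facet_integral => // y Fy; rewrite BE// pevalZ pevalM mulrA.
rewrite -mulN1r -facet_integralZ// -facet_integralD//.
rewrite (scalerA (-1)) (mulrC (-1)) -scalerA.
rewrite -scalerDr scalerAl -mulrDl facet_integralZ//.
by move/eqP; rewrite mulf_eq0 invr_eq0 gt_eqF//= => /eqP.
Qed.

End polynomial_representative.
End conservation.

Theorem proposition2 (R : realType) (d : nat) (hd : (2 <= d <= 3)%N)
    (Omega : set 'rV[R]_d) (hOmega : bounded_lipschitz_domain Omega)
    (rho : R) (hrho : 0 < rho)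
    (T : mesh R d) (hT : triangulation T Omega)
    (k : nat) (hk : (1 <= k)%N)
    (n : 'I_(nel T) -> {set 'I_(nnode T)} -> 'rV[R]_d)
    (hn : forall e F, F \in elt_facets e ->
       outward_unit_normal (element e) F (n e F))
    (nOmega : {set 'I_(nnode T)} -> 'rV[R]_d)
    (hnOmega : forall F, F \in boundary_facets T Omega ->
       outward_unit_normal Omega F (nOmega F))
    (u uhat : 'rV[R]_d -> 'rV[R]_d)
    (hu : Vh T k Omega u) (huhat : Vhat T k uhat)
    (hdiv : forall q, Qh T k Omega q ->
       \sum_(e < nel T)
         \int[leb R d]_(x in element e) (rho^-1 * divergence u x * q x) = 0)
    (hflux : forall qhat, Qhat T k qhat ->
       \sum_(e < nel T) \sum_(F in elt_facets e)
         facet_integral F (fun x =>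
           rho^-1 * dotv (trace_from e u x) (n e F) * qhat x)
       - \sum_(F in boundary_facets T Omega)
         facet_integral F (fun x =>
           rho^-1 * dotv (uhat x) (nOmega F) * qhat x) = 0) :
  [/\ forall (e : 'I_(nel T)) x, element e x -> divergence u x = 0,
      forall F, F \in interior_facets T ->
        forall e e', e != e' -> F \in elt_facets e -> F \in elt_facets e' ->
        forall x, open_simplex F x -> jump n F e e' u x = 0
    & forall F, F \in boundary_facets T Omega ->
        forall e, F \in elt_facets e ->
        forall x, open_simplex F x ->
        dotv (trace_from e u x) (nOmega F) = dotv (uhat x) (nOmega F)].
Proof.
(* Dimension 0 contradicts [hd]; the successor form turns the facet dimension [d.-1] into d. *)
destruct d as [|d]; first by [].
have [P HP] := Vh_peval hu; split.
- exact: (divergence_free hOmega hT hk hrho HP hdiv).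
- move=> F _ e e' ee' Fe Fe' x Fx.
  exact: (jump_eq0 hOmega hT hrho HP hn hnOmega hflux ee' Fe Fe' Fx).
- move=> F FO e Fe x Fx.
  exact: (boundary_flux hOmega hT hrho HP hn hnOmega huhat hflux FO Fe Fx).
Qed.
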